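(* Let $R$ be a ring. Suppose $R$ satisfies the generating hypothesis and one of the following hypotheses holds: (1) $R$ is local (it has a unique maximal right ideal); (2) $R$ is semiperfect (every finitely generated module has a projective cover); (3) $R$ is reduced (no nonzero nilpotents) and has finite uniform dimension; (4) $R$ has zero Jacobson radical and finite uniform dimension; (5) $R$ is right nonsingular (the only element whose right annihilator is essential in $R$ is $0$) and has finite uniform dimension; (6) $R$ is simple (no nontrivial two-sided ideals) and has finite uniform dimension. Then $R$ is von Neumann regular.
   Context: Rings are associative with unit; all modules are right modules. $\mathcal{D}(R)$ is the unbounded derived category of right $R$-modules. A perfect complex is a bounded chain complex of finitely generated projective right $R$-modules. $R$ satisfies the generating hypothesis (also phrased as: the generating hypothesis holds in $\mathcal{D}(R)$) if whenever $f\colon X\to Y$ is a map in $\mathcal{D}(R)$ between perfect complexes with $H_*f=0$, then $f=0$ in $\mathcal{D}(R)$. $R$ has finite uniform dimension if $R$ contains no infinite direct sum of nonzero right ideals. In (5), ''essential in $R$'' means essential as a right ideal. $R$ is von Neumann regular if for every $x\in R$ there is $y\in R$ with $x=xyx$. *)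

(* Defs.v *)
From HB Require Import structures.
From mathcomp Require Import all_boot all_algebra.
From mathcomp Require Import generic_quotient ring_quotient.
From mathcomp Require Import boolp classical_sets cardinality.

Set Implicit Arguments.
Unset Strict Implicit.
Unset Printing Implicit Defensive.

Import GRing.Theory.
Local Open Scope ring_scope.
Local Open Scope quotient_scope.
Local Open Scope classical_set_scope.

(* Rings are [pzRingType]s: associative with unit, the zero ring included.
   A right R-module is a left module over the converse ring R^c, so that
   (a : R^c) *: v stands for v a.  All types of this library carry a choice
   structure, which is no restriction since [boolp] is classical. *)
Notation rmodType R := (lmodType R^c).

Section RightIdeals.
Variable R : pzRingType.
Implicit Types I J M : set R.

Definition right_ideal I : Prop :=
  [/\ I 0, (forall x y, I x -> I y -> I (x + y))
         & (forall x a, I x -> I (x * a))].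

Definition two_sided_ideal I : Prop :=
  right_ideal I /\ (forall a x, I x -> I (a * x)).

Definition maximal_right_ideal M : Prop :=
  [/\ right_ideal M, M <> setT
    & forall J, right_ideal J -> M `<=` J -> J = M \/ J = setT].

Definition local_ring : Prop := exists! M, maximal_right_ideal M.

Definition jacobson_radical : set R :=
  [set x | forall M, maximal_right_ideal M -> M x].

Definition reduced_ring : Prop :=
  forall (x : R) (n : nat), x ^+ n = 0 -> x = 0.

Definition essential_right_ideal I : Prop :=
  right_ideal I /\
  forall J, right_ideal J -> J <> [set 0] -> I `&` J <> [set 0].

Definition right_annihilator (x : R) : set R := [set a | x * a = 0].

Definition right_nonsingular : Prop :=
  forall x : R, essential_right_ideal (right_annihilator x) -> x = 0.

Definition simple_ring : Prop :=
  forall I, two_sided_ideal I -> I = [set 0] \/ I = setT.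

Definition von_neumann_regular : Prop :=
  forall x : R, exists y : R, x = x * y * x.

(* The sum of the family I is direct: finitely many elements taken from
   distinct members and summing to zero are all zero. *)
Definition direct_family (T : choiceType) (I : T -> set R) : Prop :=
  forall (s : seq T) (x : T -> R), uniq s -> (forall t, I t (x t)) ->
    \sum_(t <- s) x t = 0 -> forall t, t \in s -> x t = 0.

Definition finite_uniform_dimension : Prop :=
  forall (T : choiceType) (I : T -> set R),
    (forall t, right_ideal (I t) /\ I t <> [set 0]) ->
    direct_family I -> finite_set [set: T].

End RightIdeals.
Arguments local_ring : clear implicits.
Arguments jacobson_radical : clear implicits.
Arguments reduced_ring : clear implicits.
Arguments right_nonsingular : clear implicits.
Arguments simple_ring : clear implicits.
Arguments von_neumann_regular : clear implicits.
Arguments finite_uniform_dimension : clear implicits.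

Section Modules.
Variable R : pzRingType.

Definition submodule (M : rmodType R) (N : set M) : Prop :=
  [/\ N 0, (forall x y, N x -> N y -> N (x + y))
         & (forall (a : R^c) x, N x -> N (a *: x))].

Definition finitely_generated (M : rmodType R) : Prop :=
  exists (n : nat) (e : 'I_n -> M),
    forall x, exists a : 'I_n -> R^c, x = \sum_i a i *: e i.

Definition surjective_map (A B : Type) (f : A -> B) : Prop :=
  forall y, exists x, f x = y.

Definition projective (P : rmodType R) : Prop :=
  forall (A B : rmodType R) (p : {linear A -> B}) (f : {linear P -> B}),
    surjective_map p -> exists h : {linear P -> A}, p \o h =1 f.

Definition superfluous (M : rmodType R) (K : set M) : Prop :=
  forall L : set M, submodule L ->
    (forall x, exists k l, [/\ K k, L l & x = k + l]) -> L = setT.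

Definition has_projective_cover (M : rmodType R) : Prop :=
  exists (P : rmodType R) (p : {linear P -> M}),
    [/\ projective P, surjective_map p & superfluous [set x | p x = 0]].

Definition semiperfect : Prop :=
  forall M : rmodType R, finitely_generated M -> has_projective_cover M.

End Modules.
Arguments semiperfect : clear implicits.

(* Unbounded chain complexes.  The differential is given between any two
   degrees and vanishes unless it lowers the degree by one; this avoids
   casts along equalities of degrees such as (n - 1) + 1 = n. *)
Record complex (R : pzRingType) := Complex {
  obj :> int -> rmodType R;
  diff : forall i j : int, {linear obj i -> obj j};
  diff_shape : forall i j : int, i <> j + 1 -> forall x, diff i j x = 0;
  diff_diff : forall (i j k : int) x, diff j k (diff i j x) = 0
}.
Arguments diff {R} X i j : rename.

Record chain_map (R : pzRingType) (X Y : complex R) := ChainMap {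
  cmap :> forall n : int, {linear X n -> Y n};
  cmap_diff : forall (i j : int) x,
    diff Y i j (cmap i x) = cmap j (diff X i j x)
}.

Section Complexes.
Variable R : pzRingType.
Implicit Types X Y Z : complex R.

Program Definition chain_id X : chain_map X X :=
  @ChainMap R X X (fun n => idfun) _.

Program Definition chain_zero X Y : chain_map X Y :=
  @ChainMap R X Y (fun n => \0) _.
Next Obligation. by rewrite /= linear0. Qed.

Program Definition chain_comp X Y Z (g : chain_map Y Z) (f : chain_map X Y) :
    chain_map X Z :=
  @ChainMap R X Z (fun n => g n \o f n) _.
Next Obligation. by rewrite /= !cmap_diff. Qed.

Definition homotopic X Y (f g : chain_map X Y) : Prop :=
  exists h : forall i j : int, {linear X i -> Y j},
    forall (n : int) (x : X n),
      f n x - g n x = diff Y (n + 1) n (h n (n + 1) x)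
                      + h (n - 1) n (diff X n (n - 1) x).

End Complexes.

Section Homology.
Variable R : pzRingType.
Implicit Types X Y : complex R.

Definition cycle_pred X n : pred (X n) := fun x => diff X n (n - 1) x == 0.
Arguments cycle_pred : clear implicits.

Lemma cycle_pred_zmod X n : zmod_closed (cycle_pred X n).
Proof.
split=> [|x y /eqP hx /eqP hy]; apply/eqP; first by rewrite linear0.
by rewrite linearB hx hy subrr.
Qed.
HB.instance Definition _ X n :=
  GRing.isZmodClosed.Build (X n) (cycle_pred X n) (cycle_pred_zmod X n).

Record cycle X (n : int) :=
  Cycle { cycle_val : X n; _ : cycle_val \in cycle_pred X n }.
HB.instance Definition _ X n := [isSub for @cycle_val X n].
HB.instance Definition _ X n := [Choice of cycle X n by <:].
HB.instance Definition _ X n := [SubChoice_isSubZmodule of cycle X n by <:].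

Definition boundary X n : pred (cycle X n) :=
  fun z => `[< exists y : X (n + 1), diff X (n + 1) n y = val z >].
Arguments boundary : clear implicits.

Lemma boundary_zmod X n : zmod_closed (boundary X n).
Proof.
split=> [|z t /asboolP[u hu] /asboolP[v hv]]; apply/asboolP.
  by exists 0; rewrite linear0 raddf0.
by exists (u - v); rewrite linearB raddfB hu hv.
Qed.
HB.instance Definition _ X n :=
  GRing.isZmodClosed.Build (cycle X n) (boundary X n) (boundary_zmod X n).

Definition homology X (n : int) : zmodType :=
  Quotient.quot (GRing.ZmodClosed.clone _ (boundary X n) _).

Definition homology_class X n (z : cycle X n) : homology X n :=
  \pi_(Quotient.quot (GRing.ZmodClosed.clone _ (boundary X n) _)) z.

Lemma homology_class_eq X n (z t : cycle X n) :
  homology_class z = homology_class t <->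
  exists y : X (n + 1), diff X (n + 1) n y = val z - val t.
Proof.
rewrite -raddfB; split=> [|h]; last first.
  by apply/eqP; rewrite -Quotient.idealrBE; apply/asboolP.
by move/eqP; rewrite -Quotient.idealrBE => /asboolP.
Qed.

Lemma cycle_map_subproof X Y (f : chain_map X Y) n (z : cycle X n) :
  f n (val z) \in cycle_pred Y n.
Proof. by apply/eqP; rewrite cmap_diff (eqP (valP z)) linear0. Qed.

Definition cycle_map X Y (f : chain_map X Y) n (z : cycle X n) : cycle Y n :=
  Cycle (cycle_map_subproof f z).

Definition homology_map X Y (f : chain_map X Y) n (a : homology X n) :
    homology Y n :=
  homology_class (cycle_map f (repr a)).
Arguments homology_map {X Y} f n a.

Lemma homology_mapE X Y (f : chain_map X Y) n (z : cycle X n) :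
  homology_map f n (homology_class z) = homology_class (cycle_map f z).
Proof.
apply/homology_class_eq => /=.
have /homology_class_eq[y hy] :
    homology_class (repr (homology_class z)) = homology_class z.
  by rewrite {1}/homology_class reprK.
by exists (f (n + 1) y); rewrite cmap_diff hy linearB.
Qed.

Definition quasi_iso X Y (f : chain_map X Y) : Prop :=
  forall n, bijective (homology_map f n).

Lemma quasi_iso_surj X Y (f : chain_map X Y) (hf : quasi_iso f) n
  (b : homology Y n) : exists a : homology X n, homology_map f n a == b.
Proof. by have [g _ gK] := hf n; exists (g b); rewrite gK. Qed.

Definition homology_inv X Y (f : chain_map X Y) (hf : quasi_iso f) n
  (b : homology Y n) : homology X n := xchoose (quasi_iso_surj hf b).
Arguments homology_inv {X Y f} hf n b.

Lemma homology_invK X Y (f : chain_map X Y) (hf : quasi_iso f) n :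
  cancel (homology_inv hf n) (homology_map f n).
Proof. by move=> b; apply/eqP/(xchooseP (quasi_iso_surj hf b)). Qed.

Lemma homology_mapK X Y (f : chain_map X Y) (hf : quasi_iso f) n :
  cancel (homology_map f n) (homology_inv hf n).
Proof. by move=> a; apply: (bij_inj (hf n)); rewrite homology_invK. Qed.

Lemma homology_map_id X n : homology_map (chain_id X) n =1 id.
Proof.
move=> a; rewrite -[RHS]reprK; congr homology_class.
exact: val_inj.
Qed.

Lemma homology_map_comp X Y Z (g : chain_map Y Z) (f : chain_map X Y) n :
  homology_map (chain_comp g f) n =1
  homology_map g n \o homology_map f n.
Proof.
move=> a /=; rewrite [homology_map f n a]/homology_map homology_mapE.
by congr homology_class; apply: val_inj.
Qed.

Lemma homotopic_homology X Y (f g : chain_map X Y) n :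
  homotopic f g -> homology_map f n =1 homology_map g n.
Proof.
case=> h hfg a; apply/homology_class_eq => /=.
exists (h n (n + 1) (val (repr a))).
by rewrite hfg (eqP (valP (repr a))) linear0 addr0.
Qed.

Lemma quasi_iso_id X : quasi_iso (chain_id X).
Proof. by move=> n; exists id => a; rewrite homology_map_id. Qed.

End Homology.
Arguments homology_map {R X Y} f n a.
Arguments homology_inv {R X Y f} hf n b.

(* D(R) is the localization of the homotopy category of complexes at the
   quasi-isomorphisms.  A map X -> Y of D(R) is represented by a roof
   X <- Z -> Y whose left leg is a quasi-isomorphism; two roofs represent the
   same map when, up to homotopy, they become equal on a common refinement. *)
Record dmap (R : pzRingType) (X Y : complex R) := DMap {
  apex : complex R;
  denom : chain_map apex X;
  denom_quasi_iso : quasi_iso denom;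
  numer : chain_map apex Y
}.

Section DerivedCategory.
Variable R : pzRingType.
Implicit Types X Y : complex R.

Definition dmap_eq X Y (f g : dmap X Y) : Prop :=
  exists (W : complex R) (u : chain_map W (apex f)) (v : chain_map W (apex g)),
    [/\ quasi_iso (chain_comp (denom f) u),
        homotopic (chain_comp (denom f) u) (chain_comp (denom g) v)
      & homotopic (chain_comp (numer f) u) (chain_comp (numer g) v)].

Definition dmap_of_chain X Y (f : chain_map X Y) : dmap X Y :=
  DMap (@quasi_iso_id R X) f.

Definition dmap_zero X Y : dmap X Y := dmap_of_chain (chain_zero X Y).

Definition dmap_homology X Y (f : dmap X Y) n (a : homology X n) :
    homology Y n :=
  homology_map (numer f) n (homology_inv (denom_quasi_iso f) n a).
Arguments dmap_homology {X Y} f n a.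

Lemma dmap_homology_eq X Y (f g : dmap X Y) n :
  dmap_eq f g -> dmap_homology f n =1 dmap_homology g n.
Proof.
case=> W [u [v [quv hd hn]]] a; rewrite /dmap_homology.
have [w /eqP <-] := quasi_iso_surj quv a.
rewrite {2}(homotopic_homology hd) !homology_map_comp /= !homology_mapK.
by have := homotopic_homology hn w; rewrite !homology_map_comp.
Qed.

Lemma dmap_homology_of_chain X Y (f : chain_map X Y) n :
  dmap_homology (dmap_of_chain f) n =1 homology_map f n.
Proof.
move=> a; rewrite /dmap_homology /=; congr homology_map.
by rewrite -[LHS]homology_map_id homology_invK.
Qed.

Definition perfect_complex X : Prop :=
  (forall n, finitely_generated (X n) /\ projective (X n)) /\
  exists a b : int, forall n : int, (n < a) || (b < n) ->
    forall x : X n, x = 0.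

End DerivedCategory.
Arguments dmap_homology {R X Y} f n a.

Definition generating_hypothesis (R : pzRingType) : Prop :=
  forall X Y : complex R, perfect_complex X -> perfect_complex Y ->
  forall f : dmap X Y,
    (forall (n : int) (a : homology X n), dmap_homology f n a = 0) ->
    dmap_eq f (dmap_zero X Y).
Arguments generating_hypothesis : clear implicits.

(* Main.v *)
(* Write r(x) for the right annihilator of x.  A chain map from R^n -> R to
   R -> R, both placed in degrees 1 and 0, that is zero in degree 0 and is given
   by a row c in degree 1 kills homology as soon as c vanishes on the kernel
   of the first differential.  The generating hypothesis makes it null-homotopic.
   Two consequences follow:
   - if c kills r(x), then c lies in R x;
   - if a b_i = 0 for i < n, then some s with a s = 0 satisfies s b_i = b_i.
   Hence a is regular as soon as r(a) = s R with s acting as a left unit on r(a).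
   When R is right nonsingular of finite uniform dimension, r(a) contains an
   essential finitely generated right ideal, and the s attached to its
   generators acts as a unit on all of r(a).  Reduced rings and simple rings are
   right nonsingular, and under the first consequence the right singular ideal
   lies in the Jacobson radical.
   In the semiperfect case the projective cover of a R has the form e R, with
   a = a e and r(a) superfluous modulo (1 - e) R; a local ring has this property
   with e = 1.  If a b = 0, an s with a s = 0 and s e b = e b then satisfies
   (e - e s e) e b = 0 with e - e s e invertible in e R e, so e b = 0, and
   therefore e lies in R a. *)
From HB Require Import structures.
Require Import Defs.
From mathcomp Require Import all_boot all_algebra.
From mathcomp Require Import boolp classical_sets cardinality.

Set Implicit Arguments.
Unset Strict Implicit.
Unset Printing Implicit Defensive.

Import GRing.Theory.
Local Open Scope ring_scope.

(** * Lifting cycles and boundaries along a quasi-isomorphism *)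

Section QuasiIso.
Variables (R : pzRingType) (X Y : complex R) (f : chain_map X Y).
Hypothesis qf : quasi_iso f.

(** Surjectivity on homology. The degrees are variables tied by equations, so that literal ones such
    as -1, 0, 1 need no cast. *)
Lemma quasi_iso_cycle_lift (l m n : int) (y : Y m) :
    n = m + 1 -> l = m - 1 -> diff Y m l y = 0 ->
  exists (x : X m) (t : Y n), diff X m l x = 0 /\ f m x = y + diff Y n m t.
Proof.
move=> -> -> /eqP yP; have [a /eqP] := quasi_iso_surj qf (homology_class (Cycle yP)).
have -> : a = homology_class (repr a) by rewrite /homology_class reprK.
rewrite homology_mapE => /homology_class_eq[t /= tE].
exists (val (repr a)), t; split; first exact/eqP/(valP (repr a)).
by rewrite tE addrCA subrr addr0.
Qed.

(** Injectivity on homology, comparing the class of [x] with that of 0. *)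
Lemma quasi_iso_boundary_lift (l m n : int) (x : X m) (t : Y n) :
    n = m + 1 -> l = m - 1 -> diff X m l x = 0 -> f m x = diff Y n m t ->
  exists w : X n, x = diff X n m w.
Proof.
move=> nE lE; subst n l => /eqP xP fx.
have /homology_class_eq[w /= wE] :
    homology_class (Cycle xP) = homology_class (0 : Defs.cycle X m).
  apply: (bij_inj (qf m)); rewrite !homology_mapE; apply/homology_class_eq.
  by exists t; rewrite /= fx linear0 subr0.
by exists w; rewrite wE subr0.
Qed.

End QuasiIso.

(** * Two-term complexes of free right modules *)

Section TwoTerm.
Variable R : pzRingType.

Lemma free_finitely_generated n :
  finitely_generated ('rV[R^c]_n : rmodType R).
Proof.
exists n, (delta_mx 0) => v; exists (fun i => v 0 i); exact: row_sum_delta.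
Qed.

Lemma free_projective n : projective ('rV[R^c]_n : rmodType R).
Proof.
move=> A B p f p_surj.
have [g gE] := choice (fun i => p_surj (f (delta_mx 0 i))).
pose h (v : 'rV[R^c]_n) := \sum_i v 0 i *: g i.
have h_lin : linear h.
  move=> a u v; rewrite /h scaler_sumr -big_split /=; apply: eq_bigr => i _.
  by rewrite !mxE scalerDl scalerA.
pose hL := GRing.isLinear.Build R^c 'rV[R^c]_n A _ h h_lin.
pose hh : {linear 'rV[R^c]_n -> A} := HB.pack h hL.
exists hh => v /=; rewrite /h linear_sum [in RHS](row_sum_delta v) linear_sum.
by apply: eq_bigr => i _; rewrite !linearZ /= gE.
Qed.


Definition rank_at (n : nat) (i : int) : nat := if i == 1 then n else i == 0.

(* The coefficients are indexed by [nat] and the dimensions are arbitrary, so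
   that one formula describes a map in every degree. *)
Definition column_mx (p : bool) (b : nat -> R^c) m n : 'M[R^c]_(m, n) :=
  \matrix_(i, j) if p then b i else 0.

Lemma column_mx0 (p : bool) b m n : (p -> forall i, (i < m)%N -> b i = 0) ->
  column_mx p b m n = 0.
Proof. by move=> b0; apply/matrixP => i j; rewrite !mxE; case: p b0 => // ->. Qed.

(** Products of [R^c] are reversed, so a row vector times this column is left multiplication by [b]
    in [R]. *)
Lemma mulmx_columnE (p : bool) (b : nat -> R) m n (x : 'rV[R^c]_m) j :
  (x *m column_mx p b m n) 0 j = if p then \sum_(i < m) b i * x 0 i else 0.
Proof.
rewrite mxE; case: p; last by rewrite big1 // => i _; rewrite mxE mulr0.
by apply: eq_bigr => i _; rewrite mxE.
Qed.

Lemma mul_column_mx p q b c m k n :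
  column_mx p b m k *m column_mx q c k n =
  column_mx (p && q) (fun i => \sum_(l < k) b i * c l) m n.
Proof.
apply/matrixP => i j; rewrite !mxE; case: p q => -[] /=.
- by apply: eq_bigr => l _; rewrite !mxE.
- by rewrite big1 // => l _; rewrite !mxE mulr0.
- by rewrite big1 // => l _; rewrite !mxE mul0r.
- by rewrite big1 // => l _; rewrite !mxE mul0r.
Qed.

Section Complex.
Variables (n : nat) (b : nat -> R^c).

Definition two_term_obj (i : int) : rmodType R := 'rV[R^c]_(rank_at n i).

Definition two_term_diff (i j : int) :
    {linear two_term_obj i -> two_term_obj j} :=
  mulmxr (column_mx ((i == 1) && (j == 0)) b (rank_at n i) (rank_at n j)).

Lemma two_term_shape i j : i <> j + 1 -> forall x, two_term_diff i j x = 0.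
Proof.
move=> ij x; rewrite /two_term_diff /= column_mx0 ?mulmx0 //.
by case/andP => /eqP iE /eqP jE; case: ij; rewrite iE jE.
Qed.

Lemma two_term_diff_diff i j k x :
  two_term_diff j k (two_term_diff i j x) = 0.
Proof.
rewrite /two_term_diff /= -mulmxA mul_column_mx column_mx0 ?mulmx0 //.
by case/andP => /andP[_ /eqP ->].
Qed.

(* [R^n -> R] in degrees 1 and 0, sending the i-th basis vector to [b i]. *)
Definition two_term : complex R := Complex two_term_shape two_term_diff_diff.

Lemma two_term_perfect : perfect_complex two_term.
Proof.
split=> [i|]; first by split; [exact: free_finitely_generated | exact: free_projective].
exists 0, 1 => i iE x; have r0 : rank_at n i = 0%N.
  by rewrite /rank_at; move: iE; do 2![case: eqP => [->|_] //].
by apply/rowP => -[j jr]; suff: (j < 0)%N by []; rewrite -r0.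
Qed.

End Complex.

Section ChainMap.
Variables (n : nat) (b c : nat -> R^c) (a : R^c).
Hypothesis ac0 : forall i, (i < n)%N -> c i * a = 0.

Definition degree_one_cmap (i : int) :
    {linear two_term n b i -> two_term 1 (fun=> a) i} :=
  mulmxr (column_mx (i == 1) c (rank_at n i) (rank_at 1 i)).

(** Both composites vanish: one by [ac0], the other because the differential only reaches degree 0,
    where the map is zero. *)
Lemma degree_one_cmap_diff i j x :
  diff (two_term 1 (fun=> a)) i j (degree_one_cmap i x) =
  degree_one_cmap j (diff (two_term n b) i j x).
Proof.
rewrite /degree_one_cmap /= /two_term_diff /= -!mulmxA !mul_column_mx.
rewrite (column_mx0 (p := _ && _)); last first.
  move=> /andP[/eqP -> _] k; rewrite /rank_at eqxx => kn.
  by rewrite big1 // => l _; rewrite ac0.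
rewrite column_mx0 // => /andP[/andP[_ /eqP ->]] //.
Qed.

Definition degree_one_map : chain_map (two_term n b) (two_term 1 (fun=> a)) :=
  ChainMap degree_one_cmap_diff.

End ChainMap.

End TwoTerm.

(** The null-homotopy [h] lives on some [W] quasi-isomorphic to [X]. If [W] were [X], then [s] would
    be [h] of the generator in degree 0; in general the bases of [X] are lifted to [W] up to
    correction terms. *)
Lemma generating_hypothesis_factor (R : pzRingType) n (b c : nat -> R) (a : R) :
    generating_hypothesis R -> (forall i, (i < n)%N -> a * c i = 0) ->
    (forall v : nat -> R, \sum_(i < n) b i * v i = 0 ->
       \sum_(i < n) c i * v i = 0) ->
  exists s, a * s = 0 /\ forall i, (i < n)%N -> c i = s * b i.
Proof.
move=> GH ac bc.
pose X := two_term n (b : nat -> R^c); pose Y := two_term 1 (fun=> a : R^c).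
pose f : chain_map X Y := @degree_one_map R n b c a ac.
have f_cycle i (x : X i) : diff X i (i - 1) x = 0 -> f i x = 0.
  rewrite /= /two_term_diff /=; case: (eqVneq i 1) x => [->|i1] x; last first.
    by move=> _; rewrite column_mx0 ?mulmx0.
  have {}bc : \sum_(l < n) b l * (x : 'rV[R^c]_n) 0 l = 0 ->
      \sum_(l < n) c l * (x : 'rV[R^c]_n) 0 l = 0.
    (* [bc] takes functions on [nat], so the entries of [x] are extended by 0. *)
    pose w k : R := if insub k is Some l then (x : 'rV[R^c]_n) 0 l else 0.
    have wE (l : 'I_n) : (x : 'rV[R^c]_n) 0 l = w l by rewrite /w valK.
    under eq_bigr => l _ do rewrite wE.
    by under [in X in _ -> X = _]eq_bigr => l _ do rewrite wE; exact: bc.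
  move=> bx0; apply/rowP => j; rewrite mulmx_columnE mxE; apply: bc.
  have := congr1 (fun M : 'rV[R^c]_1 => M 0 0) bx0.
  by rewrite mulmx_columnE mxE.
have f_homology i (z : homology X i) : dmap_homology (dmap_of_chain f) i z = 0.
  rewrite dmap_homology_of_chain.
  have -> : z = homology_class (repr z) by rewrite /homology_class reprK.
  have <- : homology_class (0 : Defs.cycle Y i) = 0 by apply: raddf0.
  rewrite homology_mapE; apply/homology_class_eq.
  exists 0; rewrite linear0 subr0; apply/esym/f_cycle/eqP.
  exact: (valP (repr z)).
have [W [u [v [qu _ [h hE]]]]] :=
  GH X Y (two_term_perfect n b) (two_term_perfect 1 _) (dmap_of_chain f) f_homology.
(* The generator 1 of [X 0] lifts to a cycle [z], up to the boundary of some [y]. *)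
have [z [y [dz uz]]] : exists (z : W 0) (y : X 1),
    diff W 0 (-1) z = 0 /\ u 0 z = (const_mx 1 : 'rV[R^c]_1) + diff X 1 0 y.
  apply: (quasi_iso_cycle_lift qu) => //.
  by rewrite /= /two_term_diff /= column_mx0 ?mulmx0.
have dX (x : 'rV[R^c]_n) :
    (diff X 1 0 x : 'rV[R^c]_1) = const_mx (\sum_(l < n) b l * x 0 l).
  by apply/rowP => j; rewrite mulmx_columnE mxE.
(* [b k *: u 0 z] is the boundary of [e], so [b k *: z] is the boundary of some [w1]. The cycle
   [u 1 w1 - e] lifts exactly, as [X 2] is zero, and subtracting its lift from [w1] gives [w]. *)
have w_ex (k : 'I_n) : exists w : W 1, diff W 1 0 w = (b k : R^c) *: z /\
    u 1 w = (delta_mx 0 k : 'rV[R^c]_n) + (b k : R^c) *: y.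
  set e := _ + _ : X 1.
  have de : (b k : R^c) *: u 0 z = diff X 1 0 e.
    rewrite /e linearD linearZ_LR /= uz scalerDr; congr (_ + _).
    rewrite -[RHS]/(diff X 1 0 _) dX; apply/rowP => j; rewrite !mxE.
    rewrite (bigD1 k) //= big1 => [|l lk].
      by rewrite mxE !eqxx addr0 !mulr1.
    by rewrite mxE (negPf lk) andbF mulr0.
  have [w1 w1E] : exists w1 : W 1, (b k : R^c) *: z = diff W 1 0 w1.
    apply: (@quasi_iso_boundary_lift R W X _ qu (-1) 0 1 _ e) => //.
      by rewrite linearZ_LR dz scaler0.
    by rewrite linearZ_LR.
  have [|t [y2 [dt ut]]] :=
      @quasi_iso_cycle_lift R W X _ qu 0 1 2 (u 1 w1 - e) erefl erefl.
    by rewrite linearB cmap_diff -w1E linearZ_LR de subrr.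
  exists (w1 - t); split; first by rewrite linearB dt subr0 w1E.
  move: ut => /= ut; rewrite linearB ut.
  have -> : y2 = 0 by apply/rowP => -[].
  by rewrite mul0mx addr0 opprB addrC subrK.
have dY (x : 'rV[R^c]_1) : (diff Y 1 0 x : 'rV[R^c]_1) 0 0 = a * x 0 0.
  by rewrite mulmx_columnE big_ord1.
have f0 (x : X 0) : f 0 x = 0.
  by rewrite /= column_mx0 ?mulmx0.
have h0 : diff Y 1 0 (h 0 1 z) = 0.
  have : f 0 (u 0 z) - 0 = diff Y 1 0 (h 0 1 z) + h (-1) 0 (diff W 0 (-1) z).
    exact: (hE 0 z).
  by rewrite subr0 f0 dz linear0 addr0.
have h1 (w : W 1) : f 1 (u 1 w) = h 0 1 (diff W 1 0 w).
  have : f 1 (u 1 w) - 0 = diff Y 2 1 (h 1 2 w) + h 0 1 (diff W 1 0 w).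
    exact: (hE 1 w).
  have -> : h 1 2 w = 0 by apply/rowP => -[].
  by rewrite subr0 linear0 add0r.
(* Subtracting [f 1 y] offsets the correction by [y] in the lifts [z] and [w]. *)
exists ((h 0 1 z - f 1 y : 'rV[R^c]_1) 0 0); split.
  by rewrite -dY linearB h0 cmap_diff f0 subrr mxE.
move=> i ni; have [w [dw uw]] := w_ex (Ordinal ni).
have fE : f 1 (delta_mx 0 (Ordinal ni) : 'rV[R^c]_n)
    = (b i : R^c) *: (h 0 1 z - f 1 y).
  by rewrite scalerBr -!linearZ_LR -dw -h1 uw linearD addrK.
have := congr1 (fun M : 'rV[R^c]_1 => M 0 0) fE.
rewrite mulmx_columnE [in RHS]mxE => e; apply: (etrans _ e).
rewrite (bigD1 (Ordinal ni)) //= big1 => [|l lk].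
  by rewrite mxE !eqxx addr0 mulr1.
by rewrite mxE (negPf lk) andbF mulr0.
Qed.

(** * Annihilators and criteria for regularity under the generating hypothesis *)

Section Annihilators.
Variable R : pzRingType.
Hypothesis GH : generating_hypothesis R.

(** The case of one column with [a = 0], where the condition [a * c i = 0] is automatic. *)
Lemma left_multiple_of_annihilator (c x : R) :
  (forall v, x * v = 0 -> c * v = 0) -> exists y, c = y * x.
Proof.
move=> xc.
have [|v|s [_ sE]] := @generating_hypothesis_factor R 1 (fun=> x) (fun=> c) 0 GH.
- by move=> *; rewrite mul0r.
- by rewrite !big_ord1; exact: xc.
- by exists s; exact: (sE 0%N).
Qed.

Lemma annihilator_local_unit n (b : nat -> R) (a : R) :
    (forall i, (i < n)%N -> a * b i = 0) ->
  exists s, a * s = 0 /\ forall i, (i < n)%N -> b i = s * b i.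
Proof. by move=> ab; exact: (generating_hypothesis_factor GH ab). Qed.

Lemma regular_of_idempotent_cover (a e : R) : e * e = e -> a * e = a ->
  (forall t, a * t = 0 -> exists u, e * (1 - t) * u = e) ->
  exists y, a = a * y * a.
Proof.
move=> ee ae cover.
suff /left_multiple_of_annihilator[y yE] : forall b, a * b = 0 -> e * b = 0.
  by exists y; rewrite -mulrA -yE ae.
move=> b ab; have aeb : a * (e * b) = 0 by rewrite mulrA ae.
have [//|s [as0 /(_ 0%N isT) sb]] := @annihilator_local_unit 1 (fun=> e * b) a.
pose t := e * s * e.
have at0 : a * t = 0 by rewrite /t !mulrA ae as0 mul0r.
have et : e * t = t by rewrite /t !mulrA ee.
have te : t * e = t by rewrite /t -!mulrA ee.
have [u uE] := cover _ at0; pose w := e * u * e.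
have we : w * e = w by rewrite /w -!mulrA ee.
have tw : (e - t) * w = e.
  have etu : (e - t) * u = e by rewrite -[RHS]uE mulrBr mulr1 et.
  by rewrite /w !mulrA mulrBl ee te etu ee.
have wE : w = e + t * w by rewrite -[e in RHS]tw mulrBl subrK /w !mulrA ee.
(* [w] is a right inverse of [e - t] in e R e. As [w = e + t * w], a second use of [cover] gives [w]
   a right inverse too, so [w] is also a left inverse of [e - t]. *)
have [|v vE] := cover (- (t * w)); first by rewrite mulrN mulrA at0 mul0r oppr0.
have wv : w * v = e.
  by rewrite -[RHS]vE opprK mulrDr mulr1 (mulrA e t) et -wE.
have etE : e - t = e * v.
  by rewrite -[e in RHS]tw -mulrA wv mulrBl ee te.
have <- : w * (e - t) * (e * b) = e * b by rewrite etE (mulrA w) we wv mulrA ee.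
have tb : t * (e * b) = e * b.
  by rewrite /t -!mulrA (mulrA e e b) ee -sb mulrA ee.
by rewrite -mulrA mulrBl tb mulrA ee subrr mulr0.
Qed.

(** The unit [s] of the [b i] makes [1 - s] kill all of r(a), so [1 - s = y * a]; multiplying by [a]
    on the left and using [a * s = 0] gives [a = a * y * a]. *)
Lemma regular_of_finite_annihilator (a : R) n (b : nat -> R) :
    (forall i, (i < n)%N -> a * b i = 0) ->
    (forall f, (forall i, (i < n)%N -> f * b i = 0) ->
       forall z, a * z = 0 -> f * z = 0) ->
  exists y, a = a * y * a.
Proof.
move=> ab ann; have [s [as0 sb]] := annihilator_local_unit ab.
have [|y yE] := @left_multiple_of_annihilator (1 - s) a.
  by apply: ann => i ni; rewrite mulrBl mul1r -sb ?subrr.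
by exists y; rewrite -mulrA -yE mulrBr mulr1 as0 subr0.
Qed.

End Annihilators.

(** * Maximal right ideals and local rings *)

Section Local.
Variable R : pzRingType.
Local Open Scope classical_set_scope.

Lemma right_ideal_principal (x : R) : right_ideal [set x * r | r in setT].
Proof.
split; first by exists 0; rewrite ?mulr0.
  by move=> _ _ [u _ <-] [v _ <-]; exists (u + v); rewrite ?mulrDr.
by move=> _ v [u _ <-]; exists (u * v); rewrite ?mulrA.
Qed.

Lemma maximal_right_ideal_over (I : set R) : right_ideal I -> ~ I 1 ->
  exists M, maximal_right_ideal M /\ I `<=` M.
Proof.
move=> I_ideal I1.
(* Enlarging by [I] keeps the empty chain inside the collection. *)
pose P (J : set R) := right_ideal (I `|` J) /\ ~ (I `|` J) 1.
have chainP F : F `<=` P -> total_on F subset -> P (\bigcup_(X in F) X).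
  move=> FP Ftot; have [I0 ID IM] := I_ideal.
  have sub X : F X -> I `|` X `<=` I `|` \bigcup_(X in F) X.
    by move=> FX; apply: setUS => x Xx; exists X.
  split; last by case=> // -[X /FP[_ X1] ?]; apply: X1; right.
  split; first by left.
    move=> x y [Ix|[X FX Xx]] [Iy|[Y FY Yy]].
    - by left; exact: ID.
    - apply: (sub _ FY); have [[_ YD _] _] := FP _ FY.
      by apply: YD; [left|right].
    - apply: (sub _ FX); have [[_ XD _] _] := FP _ FX.
      by apply: XD; [right|left].
    have [XY|YX] := Ftot _ _ FX FY.
      apply: (sub _ FY); have [[_ YD _] _] := FP _ FY.
      by apply: YD; right => //; exact: XY.
    apply: (sub _ FX); have [[_ XD _] _] := FP _ FX.
    by apply: XD; right => //; exact: YX.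
  move=> x r [Ix|[X FX Xx]]; first by left; exact: IM.
  by apply: (sub _ FX); have [[_ _ XM] _] := FP _ FX; apply: XM; right.
have [A [[A_ideal A1] Amax]] := Zorn_bigcup chainP.
exists (I `|` A); split; last by move=> x; left.
split=> // [AT|J J_ideal AJ]; first by apply: A1; rewrite AT.
have [J1|J1] := pselect (J 1).
  right; apply/seteqP; split=> // x _; rewrite -[x]mul1r.
  by case: J_ideal => _ _; apply.
left; apply: contrapT => JA; apply: (Amax J).
  split; first by move=> x Ax; apply: AJ; right.
  by move=> JA1; apply: JA; apply/seteqP; split=> // x /JA1; right.
by rewrite /P (setUidr (subset_trans (@subsetUl _ I A) AJ)).
Qed.

(** Elements outside the unique maximal right ideal are right invertible. Were [1 - t] inside, [t]
    would be outside, and [a * t = 0] would give [a = 0]. *)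
Lemma local_ring_cover : local_ring R ->
  forall a t : R, a <> 0 -> a * t = 0 -> exists u, (1 - t) * u = 1.
Proof.
move=> [M [[[M0 MD MM] MT M_max] M_uniq]] a t a0 at0.
have M_right_inv x : ~ M x -> exists u, x * u = 1.
  move=> Mx; apply: contrapT => xR.
  have [||N [N_max xN]] := @maximal_right_ideal_over [set x * u | u in setT].
  - exact: right_ideal_principal.
  - by case=> u _ xu; apply: xR; exists u.
  by apply: Mx; rewrite (M_uniq _ N_max); apply: xN; exists 1; rewrite ?mulr1.
apply: (M_right_inv) => M1t.
have [Mt|/M_right_inv[u tu]] := pselect (M t).
  apply: MT; apply/seteqP; split=> // x _; rewrite -[x]mul1r; apply: MM.
  by rewrite -[1](subrK t); exact: MD.
by apply: a0; rewrite -[a]mulr1 -tu mulrA at0 mul0r.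
Qed.

End Local.

(** * Essential finitely generated right ideals *)

Section FiniteUniformDimension.
Variable R : pzRingType.
Local Open Scope classical_set_scope.

(* Otherwise one could keep choosing elements of [I] whose right ideals form
   an infinite direct sum. *)
Lemma essential_finite_span (I : set R) : finite_uniform_dimension R ->
  exists s : seq R, (forall x, x \in s -> I x) /\
    forall c, I c -> c != 0 -> exists r v,
      c * r != 0 /\ c * r = \sum_(i < size s) s`_i * v i.
Proof.
move=> fud; apply: contrapT => no_span.
(* The condition on [s] sits under the existential so that [choice] yields a function on all
   sequences. *)
have next (s : seq R) : exists c, (forall x, x \in s -> I x) ->
    [/\ I c, c != 0 & forall r v,
       c * r = \sum_(i < size s) s`_i * v i -> c * r = 0].
  apply: contrapT => no_c; apply: no_span; exists s; split.
    move=> x xs; apply: contrapT => Ix; apply: no_c; exists 0 => sI.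
    by case: Ix; exact: sI.
  move=> c Ic c0; apply: contrapT => no_r; apply: no_c; exists c => _.
  split=> // r v crE; apply: contrapT => /eqP cr0.
  by apply: no_r; exists r, v.
have [g gP] := choice next.
pose S n := iter n (fun s => rcons s (g s)) [::]; pose c n := g (S n).
have SE n : S n = mkseq c n.
  by elim: n => // n IHn; rewrite mkseqS -IHn.
have SI n x : x \in S n -> I x.
  elim: n x => // n IHn x; rewrite mem_rcons inE => /orP[/eqP ->|/IHn //].
  by have [] := gP _ IHn.
have c0 n : c n != 0 by have [] := gP _ (SI n).
(* Triangular elimination: the last term is a combination of earlier [c i], hence zero by the choice
   of [c n]. *)
have c_ind n (w : nat -> R) : \sum_(i < n) c i * w i = 0 ->
    forall i, (i < n)%N -> c i * w i = 0.
  elim: n => // n IHn; rewrite big_ord_recr /= => sum0.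
  have cn0 : c n * w n = 0.
    have [_ _ /(_ (w n) (fun i => - w i)) ->] // := gP _ (SI n).
    move/eqP: sum0; rewrite addrC addr_eq0 => /eqP ->.
    rewrite -sumrN SE size_mkseq; apply: eq_bigr => i _.
    by rewrite nth_mkseq // mulrN.
  move: sum0; rewrite cn0 addr0 => /IHn w0 i.
  by rewrite ltnS leq_eqVlt => /orP[/eqP ->|/w0].
apply: infinite_nat.
apply: (fud nat (fun n => [set c n * r | r in setT])) => [n|s x s_uniq xc sum0 t ts].
  split; first exact: right_ideal_principal.
  move=> cn; have : [set c n * r | r in setT] (c n) by exists 1; rewrite ?mulr1.
  by rewrite cn /= => cn0; have := c0 n; rewrite cn0 eqxx.
have x_mul n : exists r, x n = c n * r by have [r _ <-] := xc n; exists r.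
have [w wE] := choice x_mul.
pose m := (\max_(i <- s) i).+1.
have s_lt i : i \in s -> (i < m)%N.
  by move=> si; rewrite ltnS; apply: (leq_bigmax_seq (F := id)).
(* Padding with zeros turns the sum over [s] into one over an initial segment, as [c_ind]
   requires. *)
pose w' i := if i \in s then w i else 0.
have tE : x t = c t * w' t by rewrite /w' ts wE.
rewrite tE; apply: (c_ind m); last exact: s_lt.
rewrite -[RHS]sum0.
have s_perm : perm_eq s [seq i <- iota 0 m | i \in s].
  apply: uniq_perm; rewrite ?filter_uniq ?iota_uniq // => i.
  rewrite mem_filter mem_iota /= add0n.
  by case: (boolP (i \in s)) => // /s_lt ->.
rewrite (perm_big _ s_perm) big_filter /=.
rewrite -(big_mkord xpredT (fun i => c i * w' i)) /index_iota subn0.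
rewrite [RHS]big_mkcond /=; apply: eq_bigr => i _.
by rewrite /w' wE; case: ifP => _; rewrite ?mulr0.
Qed.

End FiniteUniformDimension.

(** * Right nonsingular rings *)

Section Nonsingular.
Variable R : pzRingType.
Local Open Scope classical_set_scope.

Lemma right_ideal_annihilator (x : R) : right_ideal (right_annihilator x).
Proof.
split; first exact: mulr0.
  by move=> u v xu xv; rewrite /right_annihilator /= mulrDr xu xv addr0.
by move=> u a xu; rewrite /right_annihilator /= mulrA xu mul0r.
Qed.

(** Essentiality need only be tested on principal right ideals. *)
Lemma essential_annihilatorP (x : R) :
  essential_right_ideal (right_annihilator x) <->
  forall j, j <> 0 -> exists r, j * r <> 0 /\ x * (j * r) = 0.
Proof.
split=> [[_ ess] j j0|ess].
  apply: contrapT => no_r; apply: (ess _ (right_ideal_principal j)).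
    move=> jR; apply: j0; have : [set j * r | r in setT] j.
      by exists 1; rewrite ?mulr1.
    by rewrite jR.
  apply/seteqP; split=> [_ [/[swap] -[r _ <-] xjr]|_ ->]; last first.
    by split; [exact: mulr0 | exists 0; rewrite ?mulr0].
  by apply: contrapT => jr0; apply: no_r; exists r.
split=> [|J [J0 _ JM] Jn0 xJ]; first exact: right_ideal_annihilator.
apply: Jn0; apply/seteqP; split=> [j Jj|_ -> //]; apply: contrapT => j0.
have [r [jr0 xjr]] := ess _ j0; apply: jr0.
by have : (right_annihilator x `&` J) (j * r) by [split=> //; exact: JM]; rewrite xJ.
Qed.

(** Essentiality tested at [x] itself gives x r nonzero with x x r = 0; then x r x squares to 0, and
    so does x r. *)
Lemma reduced_right_nonsingular : reduced_ring R -> right_nonsingular R.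
Proof.
move=> red x /essential_annihilatorP ess; apply: contrapT => x0.
have [r [xr0 xxr]] := ess _ x0; apply: xr0.
have xrx : x * r * x = 0.
  by apply: (red _ 2%N); rewrite expr2 -!mulrA (mulrA x r x) (mulrA x (x * r)) xxr mul0r !mulr0.
by apply: (red _ 2%N); rewrite expr2 mulrA xrx mul0r.
Qed.

(** The right singular ideal [Z] is two-sided. If it contains 1, whose right annihilator is 0, then
    the ring is zero. *)
Lemma simple_right_nonsingular : simple_ring R -> right_nonsingular R.
Proof.
move=> simp; pose Z : set R := [set x | essential_right_ideal (right_annihilator x)].
have Z_ideal : two_sided_ideal Z.
  split; last first.
    move=> a x /essential_annihilatorP ess; apply/essential_annihilatorP => j j0.
    have [r [jr0 xjr]] := ess _ j0; exists r; split=> //.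
    by rewrite -mulrA xjr mulr0.
  split.
  - apply/essential_annihilatorP => j j0; exists 1.
    by rewrite mulr1 mul0r.
  - move=> x y /essential_annihilatorP xess /essential_annihilatorP yess.
    apply/essential_annihilatorP => j j0.
    have [r [jr0 xjr]] := xess _ j0; have [q [jrq0 yjrq]] := yess _ jr0.
    exists (r * q); rewrite (mulrA j); split=> //.
    by rewrite mulrDl yjrq addr0 mulrA xjr mul0r.
  move=> x a /essential_annihilatorP ess; apply/essential_annihilatorP => j j0.
  have [aj0|aj0] := pselect (a * j = 0).
    by exists 1; rewrite mulr1 -mulrA aj0 mulr0.
  have [r [ajr0 xajr]] := ess _ aj0; exists r; split.
    by move=> jr0; apply: ajr0; rewrite -mulrA jr0 mulr0.
  by rewrite -mulrA (mulrA a).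
case: (simp _ Z_ideal) => [Z0 x Zx|ZT x _].
  by have : Z x by []; rewrite Z0.
have /essential_annihilatorP ess : Z 1 by rewrite ZT.
by apply: contrapT => /ess[r [xr0 ]]; rewrite mul1r.
Qed.

(** For singular [x], r(1 - y x) meets the essential r(x) trivially, so it is 0 and 1 - y x is left
    invertible. Hence [x] lies in the Jacobson radical. *)
Lemma jacobson_right_nonsingular : generating_hypothesis R ->
  jacobson_radical R = [set 0] -> right_nonsingular R.
Proof.
move=> GH J0 x /essential_annihilatorP ess.
have linv y : exists u, u * (1 - y * x) = 1.
  have [v yxv|u uE] := @left_multiple_of_annihilator R GH 1 (1 - y * x); last first.
    by exists u.
  rewrite mul1r; apply: contrapT => v0; have [r [vr0 xvr]] := ess _ v0.
  have vE : v = y * x * v.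
    by apply/eqP; rewrite -subr_eq0 -{1}[v]mul1r -mulrBl yxv.
  by apply: vr0; rewrite vE -!mulrA xvr mulr0.
(* [u] = 1 - (- (u y)) x is itself left invertible, hence a two-sided inverse of 1 - y x; then 1 + x
   u y is a right inverse of 1 - x y. *)
have rinv y : exists w, (1 - x * y) * w = 1.
  have [u uE] := linv y; have [u' u'E] := linv (- (u * y)).
  have uyx : u = 1 - (- (u * y)) * x.
    by rewrite mulNr opprK -uE mulrBr mulr1 mulrA subrK.
  have u'u : u' * u = 1 by rewrite {1}uyx.
  have Eu : (1 - y * x) * u = 1.
    suff -> : 1 - y * x = u' by [].
    by rewrite -[RHS]mulr1 -[X in _ = _ * X]uE mulrA u'u mul1r.
  have xuy : x * u * y - x * y * (x * u * y) = x * y.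
    by rewrite -[in RHS](mulr1 x) -Eu mulrBl mul1r mulrBr mulrBl !mulrA.
  by exists (1 + x * u * y); rewrite mulrDr mulr1 mulrBl mul1r xuy subrK.
have : jacobson_radical R x; last by rewrite J0.
move=> M [[M0 MD MM] MT M_max]; apply: contrapT => Mx; apply: MT.
(* With [x] outside [M], M + x R is everything, so some 1 - x y lies in [M]; its right inverse
   forces [M] to be everything. *)
have xR_ideal : right_ideal [set z | exists m y, M m /\ z = m + x * y].
  split.
  - by exists 0, 0; rewrite mulr0 addr0.
  - move=> _ _ [m [y [Mm ->]]] [m' [y' [Mm' ->]]]; exists (m + m'), (y + y').
    by split; [exact: MD | rewrite mulrDr addrACA].
  move=> _ a [m [y [Mm ->]]]; exists (m * a), (y * a).
  by split; [exact: MM | rewrite mulrDl mulrA].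
have [|MxM|MxT] := M_max _ xR_ideal.
- by move=> m Mm; exists m, 0; rewrite mulr0 addr0.
- case: Mx; rewrite -MxM; exists 0, 1; by rewrite add0r mulr1.
have [m [y [Mm /eqP]]] : [set z | exists m y, M m /\ z = m + x * y] 1 by rewrite MxT.
rewrite -subr_eq => /eqP m1; have [w mw] := rinv y.
by apply/seteqP; split=> // z _; rewrite -[z]mul1r -mw m1; exact/MM/MM.
Qed.

(** The [b i] generate an essential part of r(a). If [f] kills them and [z] is in r(a), then f z has
    an essential right annihilator, so f z = 0. *)
Lemma nonsingular_finite_annihilator (a : R) :
  right_nonsingular R -> finite_uniform_dimension R ->
  exists n (b : nat -> R), (forall i, (i < n)%N -> a * b i = 0) /\
    forall f, (forall i, (i < n)%N -> f * b i = 0) ->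
      forall z, a * z = 0 -> f * z = 0.
Proof.
move=> nons fud.
have [s [as0 s_ess]] := essential_finite_span (right_annihilator a) fud.
exists (size s), (nth 0 s); split=> [i si|f fs z az].
  by apply: as0; exact: mem_nth.
apply/nons/essential_annihilatorP => j j0.
have [zj0|/eqP zj0] := pselect (z * j = 0).
  by exists 1; rewrite mulr1 -mulrA zj0 mulr0.
have [|r [v [zjr0 zjrE]]] := s_ess _ _ zj0.
  by rewrite /right_annihilator /= mulrA az mul0r.
exists r; split; first by move=> jr0; move: zjr0; rewrite -mulrA jr0 mulr0 eqxx.
rewrite -mulrA (mulrA z) zjrE mulr_sumr big1 // => i _.
by rewrite mulrA fs ?mul0r.
Qed.

End Nonsingular.

(** * Principal right ideals as modules, and their projective covers *)

Section Principal.
Variables (R : pzRingType) (a : R).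

Definition principal_pred : pred R^c^o :=
  fun x => `[< exists r : R, (x : R) = a * r >].

Lemma principal_submod : submod_closed principal_pred.
Proof.
split; first by apply/asboolP; exists 0; rewrite mulr0.
move=> c x y /asboolP[r rE] /asboolP[q qE]; apply/asboolP.
exists (r * c + q); rewrite mulrDr -qE mulrA -rE; exact: erefl.
Qed.
HB.instance Definition _ :=
  GRing.isSubmodClosed.Build R^c R^c^o principal_pred principal_submod.

Record principal := Principal
  { principal_val : R^c^o; _ : principal_val \in principal_pred }.
HB.instance Definition _ := [isSub for @principal_val].
HB.instance Definition _ := [Choice of principal by <:].
HB.instance Definition _ := [SubChoice_isSubLmodule of principal by <:].

Lemma principal_generator_subproof r : (a * r : R^c^o) \in principal_pred.
Proof. by apply/asboolP; exists r. Qed.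

Definition principal_mul (r : R^c^o) : principal :=
  Principal (principal_generator_subproof r).

Lemma principal_mul_linear : linear principal_mul.
Proof.
move=> c x y; apply: val_inj; rewrite linearD linearZ /=.
by rewrite mulrDr; congr (_ + _); exact: (mulrA a (x : R) c).
Qed.
HB.instance Definition _ :=
  GRing.isLinear.Build R^c R^c^o principal _ principal_mul principal_mul_linear.

Lemma principal_mul_surj : surjective_map principal_mul.
Proof. by move=> -[x xP]; have /asboolP[r rE] := xP; exists r; apply: val_inj. Qed.

Lemma principal_finitely_generated :
  finitely_generated (principal : rmodType R).
Proof.
exists 1%N, (fun=> principal_mul 1) => x.
have [r <-] := principal_mul_surj x; exists (fun=> r : R).
by rewrite big_ord1 -linearZ; congr principal_mul; rewrite /GRing.scale /= mulr1.
Qed.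

End Principal.

Lemma regular_projective (R : pzRingType) : projective (R^c^o : rmodType R).
Proof.
move=> A B p f p_surj; have [x xE] := p_surj (f 1).
pose h (r : R^c^o) := (r : R^c) *: x.
have h_lin : linear h by move=> c u v; rewrite /h scalerDl scalerA.
pose hL := GRing.isLinear.Build R^c R^c^o A _ h h_lin.
pose hh : {linear R^c^o -> A} := HB.pack h hL.
exists hh => r; rewrite /= /h linearZ_LR xE -linearZ_LR; congr (f _).
exact: mulr1.
Qed.

Lemma semiperfect_cover (R : pzRingType) (a : R) : semiperfect R ->
  exists e, [/\ e * e = e, a * e = a &
    forall t, a * t = 0 -> exists u, e * (1 - t) * u = e].
Proof.
move=> /(_ _ (principal_finitely_generated a))[P [p [P_proj p_surj p_small]]].
have [phi phiE] := @regular_projective R _ _ p (principal_mul a) p_surj.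
have p_phi r : p (phi r) = principal_mul a r by exact: phiE.
have phiM (x r : R) : phi (x * r) = (r : R^c) *: phi x by rewrite -linearZ_LR.
(* Taking [u = 0] gives surjectivity of [phi]; taking [u = t] gives the last claim. *)
have phi_small (u : R) : a * u = 0 -> forall z, exists r, phi ((1 - u) * r) = z.
  move=> au z.
  suff LT : [set phi ((1 - u) * r) | r in [set: R]]%classic = setT.
    by have [r _ <-] : [set phi ((1 - u) * r) | r in [set: R]]%classic z;
      [rewrite LT | exists r].
  apply: p_small => [|x].
    split.
    - by exists 0 => //; rewrite mulr0 linear0.
    - move=> _ _ [r _ <-] [q _ <-]; exists (r + q) => //.
      by rewrite mulrDr linearD.
    by move=> c _ [r _ <-]; exists (r * c) => //; rewrite mulrA phiM.
  have [r rE] := principal_mul_surj (p x).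
  exists (x - phi ((1 - u) * r)), (phi ((1 - u) * r)); split.
  - rewrite /= linearB p_phi -rE; apply: val_inj => /=.
    by rewrite mulrBl mul1r mulrBr !mulrA au mul0r subr0 subrr.
  - by exists r.
  by rewrite subrK.
have phi_surj : surjective_map phi.
  by move=> z; have [r <-] := phi_small 0 (mulr0 a) z; eexists; reflexivity.
have [psi psiE] := P_proj _ _ phi idfun phi_surj.
have phi_psi z : phi (psi z) = z by exact: psiE.
pose e : R := psi (phi 1).
have eE (r : R) : e * r = psi (phi r).
  by rewrite -[in RHS](mul1r r) phiM linearZ_LR.
exists e; split.
- by rewrite eE /e phi_psi.
- have := p_phi e; rewrite phi_psi p_phi => /(congr1 val) /=.
  by rewrite mulr1.
move=> t /phi_small/(_ (phi 1))[u uE]; exists u.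
by rewrite -mulrA eE uE.
Qed.

Theorem theorem3p3 (R : pzRingType) (hGH : generating_hypothesis R)
  (hR : local_ring R
     \/ semiperfect R
     \/ (reduced_ring R /\ finite_uniform_dimension R)
     \/ (jacobson_radical R = [set 0%R]%classic /\ finite_uniform_dimension R)
     \/ (right_nonsingular R /\ finite_uniform_dimension R)
     \/ (simple_ring R /\ finite_uniform_dimension R)) :
  von_neumann_regular R.
Proof.
(* The last four hypotheses all reduce to the right nonsingular case. *)
have nonsingular_case : right_nonsingular R -> finite_uniform_dimension R ->
    von_neumann_regular R.
  move=> nons fud a.
  have [n [b [ab ann]]] := nonsingular_finite_annihilator a nons fud.
  exact: (regular_of_finite_annihilator hGH ab ann).
case: hR => [loc|[semi|[[red fud]|[[J0 fud]|[[nons fud]|[simp fud]]]]]].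
(* For [a = 0] the covering condition fails at [t = 1], so this case is set apart. *)
- move=> a; have [->|a0] := pselect (a = 0); first by exists 0; rewrite !mul0r.
  apply: (regular_of_idempotent_cover hGH (mulr1 1) (mulr1 a)) => t at0.
  by have [u uE] := local_ring_cover loc a0 at0; exists u; rewrite mul1r.
- move=> a; have [e [ee ae cover]] := semiperfect_cover a semi.
  exact: (regular_of_idempotent_cover hGH ee ae cover).
- exact: (nonsingular_case (reduced_right_nonsingular red) fud).
- exact: (nonsingular_case (jacobson_right_nonsingular hGH J0) fud).
- exact: (nonsingular_case nons fud).
- exact: (nonsingular_case (simple_right_nonsingular simp) fud).
Qed.
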